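(* Let $V:=U_1\sqcup U_2\sqcup U_3$ with $U_i:=\{u_i^1,u_i^2,u_i^3\}$ (three distinct elements) for $1\leq i\leq 3$, and let $\mathscr{K}\subseteq U_1*U_2*U_3$ be the subcomplex obtained by deleting the three edges $\{u_2^1,u_3^1\}$, $\{u_3^2,u_1^2\}$, and $\{u_1^3,u_2^3\}$, as well as all faces containing these. If $d\leq 2$ and $A\colon V\to\mathbb{R}^d$ is an arbitrary function such that $0\in\operatorname{conv}(A(U_1))\cap\operatorname{conv}(A(U_2))\cap\operatorname{conv}(A(U_3))$, then there is a face $\sigma\in\mathscr{K}$ such that $0\in\operatorname{conv}(A(\sigma))$.
   Context: $\operatorname{conv}$ is the ordinary convex hull in $\mathbb{R}^d$ ($d\ge 0$ an integer). Each $U_i$ is viewed as a $0$-dimensional simplicial complex with vertex set $U_i$, and $U_1*U_2*U_3$ is the join, i.e. the abstract simplicial complex on $V$ whose faces are the subsets of $V$ containing at most one element of each $U_i$. *)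

(* Defs.v *)
From HB Require Import structures.
From mathcomp Require Import all_boot all_order all_algebra.
From mathcomp Require Import all_classical all_reals.
From mathcomp Require Import convex.

Set Implicit Arguments.
Unset Strict Implicit.
Unset Printing Implicit Defensive.

Import Order.TTheory GRing.Theory Num.Theory.

Local Open Scope ring_scope.

Definition conv_hull (R : realType) (d : nat) (S : set 'rV[R]_d) :
    set 'rV[R]_d :=
  smallest (@convex_set R 'rV[R]_d) S.

(* The elements of 'I_3 are 0, 1, 2; these names restore counting from 1. *)
Definition idx1 : 'I_3 := Ordinal (isT : (0 < 3)%N).
Definition idx2 : 'I_3 := Ordinal (isT : (1 < 3)%N).
Definition idx3 : 'I_3 := Ordinal (isT : (2 < 3)%N).

Section Complex.

Local Open Scope set_scope.

Variable V : finType.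

(* A finite simplicial complex is given by its set of faces; the empty face is
   allowed, which is harmless since its convex hull is empty. *)

Definition colour_class (u : 'I_3 -> 'I_3 -> V) (i : 'I_3) : {set V} :=
  [set u i j | j : 'I_3].

(* The join of pairwise disjoint vertex sets, each viewed as a 0-dimensional
   complex. *)
Definition join_points (U : 'I_3 -> {set V}) : {set {set V}} :=
  [set s : {set V} | [forall i, (#|s :&: U i| <= 1)%N]].

Definition delete_faces (K E : {set {set V}}) : {set {set V}} :=
  [set s in K | [forall e in E, ~~ (e \subset s)]].

Definition complexK (u : 'I_3 -> 'I_3 -> V) : {set {set V}} :=
  delete_faces (join_points (colour_class u))
    [set [set u idx2 idx1; u idx3 idx1];
         [set u idx3 idx2; u idx1 idx2];
         [set u idx1 idx3; u idx2 idx3]].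

End Complex.

(* Main.v *)
Require Import Defs.
From mathcomp Require Import all_boot all_order all_algebra.
From mathcomp Require Import all_classical all_reals.
From mathcomp Require Import interval_inference convex ring lra.

(** The complex [K] is the clique complex of the graph [adj] on the nine
    vertices [(i, j)]: two vertices of different colours are adjacent unless
    they carry the same index [j] and [j] is the third colour. So it suffices
    to find three pairwise adjacent vertices whose images have [0] in their
    convex hull. Since [d <= 2], everything can be transported to the plane by
    an injective linear map.

    Suppose no clique captures the origin. The idea is that the argument of the
    image points then lifts from the circle to the real line, compatibly along
    all edges, because [K] is simply connected; but the hypothesis on the colour
    classes forces every vertex to have a neighbour that comes strictly after
    it, which is impossible on a finite subset of a line.

    Lifting. The signed number [cross p q] of crossings of the positive
    horizontal half-axis by the segment from [p] to [q] is a cocycle on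
    triangles that avoid the origin ([cross_cocycle]). The diagonal vertex
    [(k, k)] is adjacent to all vertices of the other two colours, so every
    edge lies in the star of a diagonal vertex, and the three stars are cones;
    hence the cocycle is a coboundary, [cross (P x) (P y) = h y - h x] on edges
    ([clique_coboundary]). The integer [h x] is the sheet on which [x] lies, and
    the lifted points are ordered lexicographically by [h] and then by argument
    in [[0, 2 pi)] (the relation [before]).

    Progress. Fix a vertex [x] with image [v]. The directions outside the
    half-open half-turn which starts just after [v] and ends at [- v] form a
    convex cone missing [0], so no colour class lies in this cone: both colours
    other than that of [x] have a vertex in the half-turn. Three vertices of
    different colours span at most one missing edge, so [x] is adjacent to one
    of these two ([adj_or]), say [w]. The image of [w] is not in direction [- v],
    because the edge avoids the origin, so [det v w > 0] ([ahead_det]) and [w]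
    comes after [x] in the lifted order ([before_or_cross]). *)

Import Order.TTheory GRing.Theory Num.Theory.
Local Open Scope classical_set_scope.
Local Open Scope ring_scope.
Set Implicit Arguments.
Unset Strict Implicit.

(** * Half-planes and orientation in the plane *)

Section Plane.
Context {R : realFieldType}.
Implicit Types (a b c e s t : R) (p q r v w : R * R).

(** With two independent linear forms as [a] and [b], this cuts out a half-plane containing
    exactly one of its two boundary rays, hence one point of each pair of
    opposite nonzero points. *)
Definition lexpos a b := (0 < a) || (a == 0) && (0 < b).

(** Both a half-open half-plane and its complement are convex cones. *)
Lemma lexpos_comb a b a' b' s t :
  lexpos a b = lexpos a' b' -> 0 <= s -> 0 <= t -> 0 < s + t ->
  lexpos (s * a + t * a') (s * b + t * b') = lexpos a b.
Proof.
move=> eqab s0 t0 st; have [s00|s00] := eqVneq s 0.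
  have {}t0 : 0 < t by move: st; rewrite s00 add0r.
  by rewrite eqab s00 /lexpos !mul0r !add0r !pmulr_rgt0// mulf_eq0 gt_eqF.
have {s00 st}s0 : 0 < s by rewrite lt_def s00.
have [->|t00] := eqVneq t 0.
  by rewrite /lexpos !mul0r !addr0 !pmulr_rgt0// mulf_eq0 gt_eqF.
have {t00}t0 : 0 < t by rewrite lt_def t00.
move: eqab.
have pp (x y : R) : 0 < x -> 0 < y -> 0 < x * y by exact: mulr_gt0.
rewrite /lexpos; case: (ltrgtP 0 a) => [a0|a0|<-] /=;
  case: (ltrgtP 0 a') => [a'0|a'0|<-] //=; rewrite ?mulr0 ?add0r ?addr0.
- by move=> _; rewrite addr_gt0 ?pp.
- by move=> _; rewrite pp.
- move=> _; have := mulr_gt0 s0 (_ : 0 < - a); have := mulr_gt0 t0 (_ : 0 < - a').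
  by rewrite !oppr_gt0 !mulrN => /(_ a'0) ? /(_ a0) ?; case: ltrgtP => //=; lra.
- move=> _; have := mulr_gt0 s0 (_ : 0 < - a); rewrite oppr_gt0 mulrN => /(_ a0) ?.
  by case: ltrgtP => //=; lra.
- by move=> ->; rewrite pp.
- move=> ->; have := mulr_gt0 t0 (_ : 0 < - a'); rewrite oppr_gt0 mulrN => /(_ a'0) ?.
  by case: ltrgtP => //=; lra.
rewrite ltxx eqxx /=; case: ltP => b0 /esym; case: ltP => b'0 // _.
  by rewrite addr_gt0 ?pp.
by apply/negbTE; rewrite -leNgt; have := mulr_ge0_le0 (ltW s0) b0;
  have := mulr_ge0_le0 (ltW t0) b'0; lra.
Qed.

Lemma lexpos00 : lexpos 0 0 = false.
Proof. by rewrite /lexpos ltxx andbF. Qed.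

Definition det p q := p.1 * q.2 - p.2 * q.1.
Definition dot p q := p.1 * q.1 + p.2 * q.2.
(** Argument in [[0, pi)]. *)
Definition up p := lexpos p.2 p.1.

(** Membership of the origin in the convex hull of three points, without
    normalising the weights, so that determinants can serve as weights. *)
Definition zero_in3 p q r := exists a b c : R,
  [/\ 0 <= a, 0 <= b, 0 <= c & 0 < a + b + c] /\
  (a * p.1 + b * q.1 + c * r.1 = 0 /\ a * p.2 + b * q.2 + c * r.2 = 0).

Lemma detC p q : det q p = - det p q.
Proof. by rewrite /det; ring. Qed.

Lemma up_comb p q r a b c :
  up q = up r -> 0 <= b -> 0 < c ->
  a * p.1 + b * q.1 + c * r.1 = 0 -> a * p.2 + b * q.2 + c * r.2 = 0 ->
  a < 0 -> up p = up q.
Proof.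
move=> eqr b0 c0 e1 e2 a0.
rewrite -[RHS](@lexpos_comb _ _ r.2 r.1 b c) ?ltr_wpDl ?(ltW c0)//.
have -> : b * q.2 + c * r.2 = (- a) * p.2 + 0 * p.2 by lra.
have -> : b * q.1 + c * r.1 = (- a) * p.1 + 0 * p.1 by lra.
by rewrite lexpos_comb//; lra.
Qed.

(** A relation with the first weight nonnegative captures the origin; with the
    first weight negative it puts [p] into the cone spanned by [q] and [r],
    hence on their side of the horizontal axis. *)
Lemma one_sided p q r a b c :
  ~ zero_in3 p q r -> up q = up r -> up p != up q ->
  a * p.1 + b * q.1 + c * r.1 = 0 -> a * p.2 + b * q.2 + c * r.2 = 0 ->
  0 <= b -> 0 < c -> False.
Proof.
move=> nz eqr npq e1 e2 b0 c0; have [a0|a0] := leP 0 a.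
  by apply: nz; exists a, b, c; do !split => //; lra.
by move: npq; rewrite (up_comb eqr b0 c0 e1 e2 a0) eqxx.
Qed.

(** If [q] and [r] were on different sides of the line spanned by [p], the last
    two weights in the identity
    [det q r * p + det r p * q + det p q * r = 0], multiplied by [e] or [- e],
    would satisfy the sign conditions of [one_sided]. The factor [e], to be
    taken as [1] or [- 1], covers both orientations. *)
Lemma same_turn p q r e :
  ~ zero_in3 p q r -> up q = up r -> up p != up q ->
  (0 < e * det p q) = (0 < e * det p r).
Proof.
have imp q' r' : ~ zero_in3 p q' r' -> up q' = up r' -> up p != up q' ->
  0 < e * det p q' -> 0 < e * det p r'.
  move=> nz eqr npq pq; rewrite ltNge; apply/negP => pr.
  apply: (one_sided (a := e * det q' r') (b := - (e * det p r'))
    (c := e * det p q') nz) => //; last by rewrite oppr_ge0.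
  - by rewrite /det; ring.
  - by rewrite /det; ring.
move=> nz eqr npq; apply/idP/idP; first exact: imp.
apply: imp; rewrite -?eqr// => -[a [b [c [[? ? ? ?] [e1 e2]]]]].
apply: nz; exists a, c, b; split; first by split => //; lra.
by split; [rewrite -[RHS]e1|rewrite -[RHS]e2]; ring.
Qed.

(** * Crossings of the positive horizontal half-axis *)

(** The segment from [p] to [q] crosses the positive half-axis, rather than the
    negative one, exactly when it changes half-planes and goes anticlockwise
    if upwards, clockwise if downwards. *)
Definition cross p q : int :=
  (~~ up p && up q && (0 < det p q))%:Z - (~~ up q && up p && (0 < det q p))%:Z.

Lemma crossC p q : cross q p = - cross p q.
Proof. by rewrite /cross opprB. Qed.

Lemma zero_in3_rot p q r : zero_in3 q r p -> zero_in3 p q r.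
Proof.
move=> [a [b [c [[? ? ? ?] [e1 e2]]]]].
exists c, a, b; split; first by split => //; lra.
by split; [rewrite -[RHS]e1|rewrite -[RHS]e2]; ring.
Qed.

(** The two sides at the vertex [p] that is alone in its half-plane cross the
    horizontal axis on the same side of the origin, so their contributions
    cancel. *)
Lemma cross_alone p q r : ~ zero_in3 p q r -> up q = up r -> up p != up q ->
  cross p q + cross q r + cross r p = 0.
Proof.
move=> nz eqr npq; rewrite (crossC p r) /cross eqr !andNb addr0.
have := same_turn 1 nz eqr npq; rewrite !mul1r => ->.
have := same_turn (-1) nz eqr npq; rewrite !mulN1r -!detC => ->.
by rewrite subrr.
Qed.

Lemma cross_cocycle p q r : ~ zero_in3 p q r ->
  cross p q + cross q r + cross r p = 0.
Proof.
have [eqr nz|nqr nz] := eqVneq (up q) (up r).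
  have [epq|npq] := eqVneq (up p) (up q); last exact: cross_alone.
  by rewrite /cross epq eqr !andNb.
have [epq|npq] := eqVneq (up p) (up q).
  rewrite addrC addrA; apply: cross_alone; first by do 2 move/zero_in3_rot.
    exact: epq.
  by rewrite epq eq_sym.
rewrite -addrA addrC; apply: cross_alone => //; first by move/zero_in3_rot.
by move: nqr npq; case: (up p); case: (up q); case: (up r).
Qed.

Lemma lexposN a b : (a != 0) || (b != 0) -> lexpos (- a) (- b) = ~~ lexpos a b.
Proof.
rewrite /lexpos !oppr_gt0 oppr_eq0.
by case: ltrgtP => //=; case: ltrgtP.
Qed.

(** Comparison of arguments in [[0, 2 pi)]. *)
Definition before p q := up p && ~~ up q || (up p == up q) && (0 < det p q).

Lemma before_irr : irreflexive before.
Proof. by move=> p; rewrite /before andbN eqxx /det mulrC subrr ltxx. Qed.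

(** Otherwise the weights [det q r], [det r p], [det p q] would all be
    nonnegative, and the upper half-plane, a convex cone, would contain [0]. *)
Lemma up_acyclic p q r : up p -> up q -> up r -> 0 < det p q -> 0 < det q r ->
  0 < det p r.
Proof.
rewrite /up => hp hq hr pq qr; rewrite ltNge; apply/negP => pr.
have hqr : lexpos (- det p r * q.2 + det p q * r.2)
                  (- det p r * q.1 + det p q * r.1).
  by rewrite lexpos_comb ?hq ?hr//; lra.
suff: lexpos (det q r * p.2 + 1 * (- det p r * q.2 + det p q * r.2))
             (det q r * p.1 + 1 * (- det p r * q.1 + det p q * r.1)).
  by rewrite (_ : _ + _ = 0) 1?(_ : det q r * p.1 + _ = 0) ?lexpos00// /det; ring.
by rewrite lexpos_comb ?hp ?hqr//; lra.
Qed.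

(** The only case with content is three points in the same half-plane; the
    lower half-plane is reduced to the upper one by the half-turn, which
    preserves determinants. *)
Lemma before_trans : transitive before.
Proof.
move=> q p r; rewrite /before.
have detNN v w : det (- v.1, - v.2) (- w.1, - w.2) = det v w.
  by rewrite /det /=; ring.
have upN v w z : 0 < det v w -> (z = v) \/ (z = w) -> up (- z.1, - z.2) = ~~ up z.
  move=> vw zE; apply: lexposN; rewrite -negb_and; apply/negP => /andP[/eqP z2 /eqP z1].
  by move: vw; rewrite /det; case: zE => <-; rewrite z1 z2; lra.
case hp : (up p); case hq : (up q); case hr : (up r) => //= pq qr.
  exact: up_acyclic pq qr.
rewrite -detNN; apply: (@up_acyclic _ (- q.1, - q.2)); rewrite ?detNN//.
- by rewrite (upN p q)//; [rewrite hp|left].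
- by rewrite (upN p q)//; [rewrite hq|right].
- by rewrite (upN q r)//; [rewrite hr|right].
Qed.

(** An anticlockwise step of less than a half-turn increases the argument, or
    else passes from the end of one sheet to the beginning of the next. *)
Lemma before_or_cross p q : 0 < det p q ->
  (0 < cross p q) || (cross p q == 0) && before p q.
Proof.
move=> pq; rewrite /cross /before pq (detC p q) oppr_gt0 (lt_gtF pq).
by case: (up p); case: (up q).
Qed.

(** If the determinant vanished, then [v] would be [0] or [w] a nonpositive
    multiple of [v], and the segment between them would contain [0]. *)
Lemma ahead_det v w z : ~ zero_in3 v w z -> ~~ lexpos (- det v w) (dot v w) ->
  0 < det v w.
Proof.
move=> nz; rewrite /lexpos negb_or oppr_gt0 -leNgt oppr_eq0 le_eqVlt eq_sym.
move=> /andP[/orP[/eqP d0|//]]; rewrite d0 eqxx -leNgt => dt; exfalso; apply: nz.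
have e1 := sqr_ge0 v.1; have e2 := sqr_ge0 v.2.
have [/eqP|nv] := eqVneq (v.1 ^+ 2 + v.2 ^+ 2) 0.
  rewrite paddr_eq0// !expf_eq0/= => /andP[/eqP v1 /eqP v2].
  by exists 1, 0, 0; rewrite v1 v2; do !split; lra.
have pv : 0 < v.1 ^+ 2 + v.2 ^+ 2 by rewrite lt_def nv addr_ge0.
(* For parallel vectors, [dot v v * w = dot v w * v]. *)
exists (- dot v w), (v.1 ^+ 2 + v.2 ^+ 2), 0; split; first by split; lra.
split.
  have -> : - dot v w * v.1 + (v.1 ^+ 2 + v.2 ^+ 2) * w.1 + 0 * z.1 =
    - det v w * v.2 by rewrite /det /dot; ring.
  by rewrite d0 oppr0 mul0r.
have -> : - dot v w * v.2 + (v.1 ^+ 2 + v.2 ^+ 2) * w.2 + 0 * z.2 =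
  det v w * v.1 by rewrite /det /dot; ring.
by rewrite d0 mul0r.
Qed.

End Plane.

(** * The complex as a clique complex *)

Definition vertex := ('I_3 * 'I_3)%type.
Implicit Types (x y z : vertex).

(** The edge deleted between two colours is the one whose endpoints both carry
    the third colour as index: in the labelling from 1, the edges
    [{u_2^1, u_3^1}], [{u_3^2, u_1^2}] and [{u_1^3, u_2^3}]. *)
Definition adj x y :=
  (x.1 != y.1) && [|| x.2 != y.2, x.2 == x.1 | x.2 == y.1].

Lemma adjC x y : adj x y = adj y x.
Proof.
rewrite /adj eq_sym (eq_sym x.2 y.2); case: (y.2 =P x.2) => [->|//].
by rewrite (orbC (x.2 == x.1)).
Qed.

Lemma adj_diag k x : k != x.1 -> adj (k, k) x.
Proof. by move=> kx; rewrite /adj kx eqxx orbT. Qed.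

Lemma colour3 (i j k l : 'I_3) : i != j -> i != k -> j != k ->
  [|| l == i, l == j | l == k].
Proof.
by case: i j k l => [[|[|[|?]]]?] [[|[|[|?]]]?] [[|[|[|?]]]?] [[|[|[|?]]]?].
Qed.

(** Otherwise the index of [x] would be the third colour for both pairs, while
    these third colours are those of [z] and of [y]. *)
Lemma adj_or x y z : x.1 != y.1 -> x.1 != z.1 -> y.1 != z.1 -> adj x y || adj x z.
Proof.
move=> xy xz yz; rewrite /adj xy xz /=.
have := colour3 x.2 xy xz yz.
case: (x.2 == y.2) => //=; case: (x.2 == z.2) => //=; rewrite ?orbT //.
by case: (x.2 == x.1); case: (x.2 == y.1); case: (x.2 == z.1).
Qed.

Lemma third_colour (i j : 'I_3) : exists k : 'I_3, (k != i) && (k != j).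
Proof.
by case: i j => [[|[|[|?]]]?] [[|[|[|?]]]?] //;
  first [by exists idx1|by exists idx2|by exists idx3].
Qed.

Section Coboundary.
Variables (G : zmodType) (c : vertex -> vertex -> G).
Hypothesis cC : forall x y, c y x = - c x y.
Hypothesis c_cocycle : forall x y z, adj x y -> adj y z -> adj z x ->
  c x y + c y z + c z x = 0.

(** In the star of the diagonal vertex [(k, k)], which is a cone, the cocycle is
    the coboundary of its values on the edges from the apex. *)
Lemma star_coboundary k x y : k != x.1 -> k != y.1 -> adj x y ->
  c x y = c (k, k) y - c (k, k) x.
Proof.
move=> kx ky xy; have kx' := adj_diag kx; have ky' := adj_diag ky.
have := c_cocycle kx' xy; rewrite adjC => /(_ ky') /eqP.
by rewrite (cC _ y) subr_eq0 => /eqP <-; rewrite addrC addKr.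
Qed.

Lemma clique_coboundary : exists h : vertex -> G,
  forall x y, adj x y -> c x y = h y - h x.
Proof.
pose d0 := (idx1, idx1); pose d1 := (idx2, idx2); pose d2 := (idx3, idx3).
(* In the labelling from 1: coning from [d0] covers colours 2 and 3; colour 1 is reached through [d1],
   and the edges between colours 1 and 2 are then checked in the star of
   [d2]. *)
pose h x := if x.1 == idx1 then c d0 d1 + c d1 x else c d0 x.
have h12 x y : adj x y -> x.1 != idx1 -> y.1 != idx1 -> c x y = h y - h x.
  move=> xy x0 y0; rewrite /h (negPf x0) (negPf y0).
  by apply: star_coboundary => //; rewrite eq_sym.
have h02 x y : adj x y -> x.1 == idx1 -> y.1 == idx3 -> c x y = h y - h x.
  move=> xy x0 y0; rewrite /h x0 (eqP y0) /=.
  rewrite (star_coboundary (k := idx2)) ?(eqP x0) ?(eqP y0)// -/d1.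
  rewrite (@star_coboundary idx1 d1 y) ?(eqP y0)//; first by rewrite opprD addrA.
  by apply: adj_diag; rewrite (eqP y0).
have h01 x y : adj x y -> x.1 == idx1 -> y.1 != idx1 -> c x y = h y - h x.
  move=> xy x0 y0; have [y2|y2] := boolP (y.1 == idx3); first exact: h02.
  rewrite (star_coboundary (k := idx3)) ?(eqP x0) 1?eq_sym// -/d2.
  have a2y : adj d2 y by apply: adj_diag; rewrite eq_sym.
  have a2x : adj x d2 by rewrite adjC; apply: adj_diag; rewrite (eqP x0).
  by rewrite (cC x) (h02 _ _ a2x)// (h12 _ _ a2y)// opprK addrA subrK.
exists h => x y xy; have [x0|x0] := boolP (x.1 == idx1); last first.
  have [y0|y0] := boolP (y.1 == idx1); last exact: h12.
  by rewrite cC h01 1?adjC// opprB.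
apply: h01 => //; apply/negP => y0; move: xy.
by rewrite /adj (eqP x0) (eqP y0) eqxx.
Qed.
End Coboundary.

(** * Escape along the lifted order *)

Lemma strict_order_max (T : finType) (r : rel T) (t0 : T) :
  irreflexive r -> transitive r -> exists t, forall t', ~~ r t t'.
Proof.
move=> rI rT; pose f t := #|[pred s | r s t]|.
case: (@arg_maxnP T t0 predT f) => // t _ tmax; exists t => t'.
apply/negP => tt'; have := tmax t' isT; rewrite /= leqNgt => /negP; apply.
apply: proper_card; apply/properP; split.
  by apply/fintype.subsetP => s; rewrite !inE => st; exact: rT tt'.
by exists t; rewrite !inE ?rI.
Qed.

Section Planar.
Context {R : realFieldType}.

(** The planar case, with the assumption on the colour classes in separated
    form: no class fits in the complement of an open-closed half-turn starting
    at [v]. *)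
Lemma rainbow_clique (P : vertex -> R * R) :
  (forall v k, ~ forall j, lexpos (- det v (P (k, j))) (dot v (P (k, j)))) ->
  ~ forall x y z, adj x y -> adj y z -> adj z x -> ~ zero_in3 (P x) (P y) (P z).
Proof.
move=> class clique.
have [|x y z xy yz zx|h hP] := @clique_coboundary _ (fun x y => cross (P x) (P y)).
- by move=> x y; exact: crossC.
- exact/cross_cocycle/clique.
pose r x y := (h x < h y) || (h x == h y) && before (P x) (P y).
have [] := @strict_order_max _ r (idx1, idx1).
- by move=> x; rewrite /r ltxx before_irr andbF.
- move=> y x z; rewrite /r; case: (ltgtP (h x) (h y)) => [xy|//|->] /=.
    by move=> _ /orP[yz|/andP[/eqP <-]]; rewrite ?xy// (lt_trans xy).
  move=> xy /orP[->//|/andP[-> /= yz]]; by rewrite (before_trans xy yz) orbT.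
move=> x xmax.
have ahead k : k != x.1 -> exists y, y.1 = k /\
    ~~ lexpos (- det (P x) (P y)) (dot (P x) (P y)).
  move=> kx; have /existsNP[j /negP jP] := class (P x) k.
  by exists (k, j).
have [k] := third_colour x.1 x.1; rewrite andbb => kx.
have [l /andP[lx lk]] := third_colour x.1 k.
have [y [yk yP]] := ahead k kx; have [z [zl zP]] := ahead l lx.
have [w xw wP] : exists2 w, adj x w & ~~ lexpos (- det (P x) (P w)) (dot (P x) (P w)).
  have nxy : x.1 != y.1 by rewrite yk eq_sym.
  have nxz : x.1 != z.1 by rewrite zl eq_sym.
  have nyz : y.1 != z.1 by rewrite yk zl eq_sym.
  by case/orP: (adj_or nxy nxz nyz) => ?; [exists y|exists z].
have [m /andP[mx mw]] := third_colour x.1 w.1.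
have := ahead_det (clique x w (m, m) xw _ (adj_diag mx)) wP.
rewrite adjC adj_diag// => /(_ isT) /before_or_cross.
rewrite (hP _ _ xw) subr_gt0 subr_eq0 (eq_sym (h w)).
by move/negP: (xmax w).
Qed.
End Planar.

(** * Transfer to convex hulls *)

Section Hull.
Context {R : realType} {d : nat}.
Implicit Types (S C : set 'rV[R]_d) (p q r : 'rV[R]_d) (a b c s t : R).

Lemma conv_rowE (l : {i01 R}) p q :
  conv l (p : convex_lmodType 'rV[R]_d) q = l%:num *: p + (1 - l%:num) *: q.
Proof. by []. Qed.

Lemma convex_comb2 C p q s t : @convex_set R 'rV[R]_d C -> C p -> C q ->
  0 <= s -> 0 <= t -> 0 < s + t -> C ((s + t)^-1 *: (s *: p + t *: q)).
Proof.
move=> cC Cp Cq s0 t0 st.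
have u0 : 0 <= s / (s + t) by rewrite divr_ge0// ltW.
have u1 : s / (s + t) <= 1 by rewrite ler_pdivrMr// mul1r; lra.
have := cC p q (Itv01 u0 u1) (mem_set Cp) (mem_set Cq).
rewrite inE; congr (C _).
rewrite conv_rowE scalerDr !scalerA /= mulrC; congr (_ + _ *: _).
by field; rewrite gt_eqF.
Qed.

Lemma convex_comb3_0 C p q r a b c : @convex_set R 'rV[R]_d C ->
  C p -> C q -> C r -> 0 <= a -> 0 <= b -> 0 <= c -> 0 < a + b + c ->
  a *: p + b *: q + c *: r = 0 -> C 0.
Proof.
move=> cC Cp Cq Cr a0 b0 c0 abc e0.
have [ab0|ab0] := eqVneq (a + b) 0.
  have cN0 : c != 0 by move: abc; rewrite ab0 add0r => /gt_eqF ->.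
  have [a00 b00] : a = 0 /\ b = 0 by split; lra.
  move: e0; rewrite a00 b00 !scale0r !add0r => /eqP.
  by rewrite scaler_eq0 (negPf cN0) => /eqP <-.
have {}ab0 : 0 < a + b by rewrite lt_def ab0 addr_ge0.
have := convex_comb2 cC (convex_comb2 cC Cp Cq a0 b0 ab0) Cr (ltW ab0) c0 abc.
by rewrite scalerA mulfV ?gt_eqF// scale1r e0 scaler0.
Qed.

(** Padding with zero coordinates embeds dimension at most two into the plane. *)
Definition plane_coord p : R * R :=
  let v := p *m (pid_mx d : 'M_(d, 2)) in (v 0 0, v 0 1).

Lemma plane_coord_lin p q s t : plane_coord (s *: p + t *: q) =
  (s * (plane_coord p).1 + t * (plane_coord q).1,
   s * (plane_coord p).2 + t * (plane_coord q).2).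
Proof. by rewrite /plane_coord mulmxDl -!scalemxAl !mxE. Qed.

Lemma plane_coord0 : plane_coord 0 = (0, 0).
Proof. by rewrite /plane_coord mul0mx !mxE. Qed.

Lemma plane_coord_eq0 p : (d <= 2)%N -> plane_coord p = (0, 0) -> p = 0.
Proof.
move=> d2 [p0 p1].
have : p *m (pid_mx d : 'M_(d, 2)) = 0.
  apply/rowP => -[[|[|//]] i2]; rewrite [RHS]mxE.
    by rewrite -p0; congr (_ _ _); apply/val_inj.
  by rewrite -p1; congr (_ _ _); apply/val_inj.
move/(congr1 (fun v => v *m (pid_mx d : 'M_(2, d)))).
by rewrite mul0mx -mulmxA pid_mx_id// pid_mx_1 mulmx1.
Qed.

(** For [v] nonzero, the condition on [p] describes the preimage of a half-open
    half-plane, which is convex and misses [0]; for [v] zero it is never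
    satisfied. *)
Lemma hull_not_ahead S v : conv_hull S 0 ->
  ~ forall p, S p -> lexpos (- det v (plane_coord p)) (dot v (plane_coord p)).
Proof.
move=> h0 hS.
pose C := [set p | lexpos (- det v (plane_coord p)) (dot v (plane_coord p))]%classic.
suff : C 0.
  by rewrite /C /= plane_coord0 /det /dot /= !mulr0 subrr addr0 oppr0 lexpos00.
apply: h0; split => // p q l; rewrite !inE /C /= => hp hq.
rewrite conv_rowE plane_coord_lin.
have s0 : 0 <= l%:num by exact: ge0.
have s1 : l%:num <= 1 by exact: le1.
move: (l%:num) s0 s1 => s s0 s1.
have := @lexpos_comb _ _ _ _ _ s (1 - s) (etrans hp (esym hq)) s0.
rewrite hp subr_ge0 => /(_ s1) H; rewrite -[is_true _]/(_ = true) -[RHS]H; last by lra.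
by congr lexpos; rewrite /det /dot /=; ring.
Qed.

End Hull.

Section Faces.
Variables (V : finType) (u : 'I_3 -> 'I_3 -> V).
Hypothesis hu : bijective (fun p : 'I_3 * 'I_3 => u p.1 p.2).

(** Vertices of the same colour are never adjacent, nor are the ends of a deleted
    edge. *)
Lemma clique_face (s : {set vertex}) : {in s &, forall x y, x != y -> adj x y} ->
  [set u x.1 x.2 | x in s]%SET \in complexK u.
Proof.
move=> cl; have uI := bij_inj hu.
have mem i j : (u i j \in [set u x.1 x.2 | x in s]%SET) = ((i, j) \in s).
  exact: (mem_imset s (i, j) uI).
have nadj x y : x != y -> ~~ adj x y ->
    ~~ ([set u x.1 x.2; u y.1 y.2]%SET \subset [set u z.1 z.2 | z in s]%SET).
  move=> xy; apply: contra; rewrite finset.subUset !finset.sub1set !mem => /andP[xs ys].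
  by apply: cl => //; move: xs ys; case: (x) (y) => [? ?] [? ?].
rewrite /complexK /delete_faces inE; apply/andP; split.
  rewrite inE; apply/forallP => i; apply/card_le1_eqP => a b.
  rewrite !inE => /andP[/imsetP[x xs ->] /imsetP[j _ xj]].
  move=> /andP[/imsetP[y ys ->] /imsetP[k _ yk]].
  have {xj}x1 : x = (i, j) by apply: uI.
  have {yk}y1 : y = (i, k) by apply: uI.
  have [->//|/(cl _ _ xs ys)] := eqVneq x y.
  by rewrite /adj x1 y1 eqxx.
apply/forall_inP => e; rewrite !inE -orbA.
by case/or3P => /eqP ->; [apply: (@nadj (idx2, idx1) (idx3, idx1))|
  apply: (@nadj (idx3, idx2) (idx1, idx2))|apply: (@nadj (idx1, idx3) (idx2, idx3))].
Qed.
End Faces.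

Theorem theorem2p6 (R : realType) (d : nat) (hd : (d <= 2)%N)
    (V : finType) (u : 'I_3 -> 'I_3 -> V)
    (hu : bijective (fun p : 'I_3 * 'I_3 => u p.1 p.2))
    (A : V -> 'rV[R]_d)
    (hA : (conv_hull (A @` [set` colour_class u idx1])
           `&` conv_hull (A @` [set` colour_class u idx2])
           `&` conv_hull (A @` [set` colour_class u idx3])) 0) :
  exists2 s : {set V}, s \in complexK u & conv_hull (A @` [set` s]) 0.
Proof.
apply: contrapT => noface.
pose P (x : vertex) := plane_coord (A (u x.1 x.2)).
apply: (@rainbow_clique _ P).
  have class k : conv_hull (A @` [set` colour_class u k]) 0.
    case: hA => [[h1 h2] h3].
    by have /or3P[] := @colour3 idx1 idx2 idx3 k isT isT isT => /eqP ->.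
  move=> v k hv; apply: (@hull_not_ahead _ _ _ v (class k)) => _ [w + <-].
  by move=> /= /imsetP[j _ ->]; exact: hv.
move=> x y z xy yz zx [a [b [c [[a0 b0 c0 abc] [e1 e2]]]]].
pose s := [set x; y; z]%SET.
apply: noface; exists [set u t.1 t.2 | t in s]%SET.
  apply: clique_face => // t1 t2; rewrite !inE -!orbA.
  by move=> /or3P[]/eqP-> /or3P[]/eqP->; rewrite ?eqxx// adjC.
have inS t : t \in s ->
    (A @` [set` [set u t.1 t.2 | t in s]%SET]) (A (u t.1 t.2)).
  by move=> ts; exists (u t.1 t.2) => //=; apply/imsetP; exists t.
move=> C [cC SC].
apply: (convex_comb3_0 cC (SC _ (inS x _)) (SC _ (inS y _)) (SC _ (inS z _))
  a0 b0 c0 abc); rewrite ?inE ?eqxx ?orbT//.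
apply: plane_coord_eq0 => //.
rewrite -[X in X + c *: _]scale1r plane_coord_lin plane_coord_lin /= !mul1r.
by rewrite e1 e2.
Qed.
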